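(* Let $\varphi:\overline{\mathbb{D}}\to\overline{\mathbb{D}}$, $\varphi\in A(\mathbb{D})$, be a finite Blaschke product different from an elliptic automorphism, with Denjoy-Wolff point $z_0\in\partial\mathbb{D}$. The following are equivalent: (i) $C_\varphi:A(\mathbb{D})\to A(\mathbb{D})$, $C_\varphi f=f\circ\varphi$, is mean ergodic on $A(\mathbb{D})$; (ii) $\varphi$ is a parabolic automorphism.
   Context: $\mathbb{D}$ is the open unit disc in $\mathbb{C}$. $A(\mathbb{D})$ is the disc algebra: the Banach space of functions continuous on $\overline{\mathbb{D}}$ and holomorphic on $\mathbb{D}$, with the sup norm. A finite Blaschke product is a map $B(z)=e^{i\lambda}\prod_{i=1}^n\frac{z-a_i}{1-z\overline{a_i}}$ with $n\ge1$, $a_1,\dots,a_n\in\mathbb{D}$, $\lambda\in\mathbb{R}$. $\varphi^n=\varphi\circ\cdots\circ\varphi$ ($n$ times). An automorphism is a bijective holomorphic self-map of $\mathbb{D}$; an elliptic automorphism is one with exactly one fixed point in $\mathbb{D}$. If a holomorphic self-map $\varphi$ of $\mathbb{D}$ is neither the identity nor an elliptic automorphism, its Denjoy-Wolff point is the unique $z_0\in\overline{\mathbb{D}}$ such that $\varphi^n\to z_0$ uniformly on compact subsets of $\mathbb{D}$. A parabolic automorphism is an automorphism with Denjoy-Wolff point $z_0\in\partial\mathbb{D}$ and $\varphi'(z_0)=1$. A bounded operator $T$ on a Banach space $X$ is mean ergodic if $\frac1n\sum_{m=1}^nT^m$ converges in the strong operator topology to some bounded operator on $X$. *)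

(* Defs.v *)
From HB Require Import structures.
From mathcomp Require Import all_boot all_order all_algebra.
From mathcomp Require Import complex.
From mathcomp Require Import all_classical all_reals all_analysis.
From mathcomp Require Import ring.

Set Implicit Arguments.
Unset Strict Implicit.
Unset Printing Implicit Defensive.

Import Order.TTheory GRing.Theory Num.Theory.
Import numFieldTopology.Exports numFieldNormedType.Exports.

Local Open Scope classical_set_scope.
Local Open Scope complex_scope.
Local Open Scope ring_scope.

(* The topology of R[i] is the one of its modulus, with R[i] as scalars; thus
   derivability in the direction 1 is complex differentiability. *)
HB.instance Definition _ (R : rcfType) := NormedModule.copy R[i] R[i]^o.

Definition disc (R : realType) : set R[i] := [set z | `|z| < 1].
Definition cdisc (R : realType) : set R[i] := [set z | `|z| <= 1].
Arguments disc {R}.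
Arguments cdisc {R}.

Definition holomorphic (R : realType) (U : set R[i]) (f : R[i] -> R[i]) :=
  forall z, U z -> derivable f z 1.

(* A function on the closed disc is encoded as a function on the plane that
   vanishes outside the closed disc, so that Leibniz equality on the disc
   algebra is equality on the closed disc. *)
Definition disc_algebra (R : realType) : {pred (R[i] -> R[i])} :=
  mem [set f : R[i] -> R[i] |
    [/\ {within cdisc, continuous f}, holomorphic disc f &
        forall z, ~ cdisc z -> f z = 0]].
Arguments disc_algebra {R}.

Record discAlgebra (R : realType) := DiscAlgebra {
  discfun :> R[i] -> R[i] ;
  discfunP : discfun \in disc_algebra }.

Section disc_algebra_lmodule.
Variable R : realType.
Local Notation C := R[i].

HB.instance Definition _ := [isSub for @discfun R].
HB.instance Definition _ := [Choice of discAlgebra R by <:].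

Lemma disc_algebra_submod_closed : submod_closed (@disc_algebra R).
Proof.
split.
  by rewrite inE; split => // x; exact: cvg_cst.
move=> a f g; rewrite !inE => -[fc fh f0] [gc gh g0]; split.
- move=> x; apply: cvgD; last exact: gc.
  by apply: cvgZl_tmp; exact: fc.
- by move=> z Dz; apply: derivableD; [apply: derivableZ; exact: fh|exact: gh].
- move=> z Dz.
  by rewrite (_ : (a *: f + g) z = a *: f z + g z) // f0 // g0 // scaler0 addr0.
Qed.

HB.instance Definition _ := GRing.isSubmodClosed.Build _ _ (@disc_algebra R)
  disc_algebra_submod_closed.
HB.instance Definition _ := [SubChoice_isSubLmodule of discAlgebra R by <:].

End disc_algebra_lmodule.


Section sup_norm.
Variable R : realType.
Local Notation C := R[i].
Import ComplexField.Normc.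
Local Notation normc := (@normc R).

Lemma normCE (z : C) : `|z| = (normc z)%:C. Proof. by []. Qed.

Lemma normCr (x : R) : `|x%:C| = `|x|%:C :> C.
Proof. by rewrite normCE /Normc.normc /= expr0n addr0 sqrtr_sqr. Qed.

Lemma normc_continuous : continuous (normc : C -> R).
Proof.
move=> z; apply/(@cvgrPdist_lt _ _ _ (nbhs z)) => e e0; near=> w.
have h : `|z - w| < e%:C.
  by near: w; apply: (@cvgr_dist_lt _ _ _ (nbhs z)) => //; rewrite ltcR.
rewrite -ltcR; apply: le_lt_trans h.
by rewrite -normCr rmorphB /= -!normCE ler_dist_dist.
Unshelve. all: by end_near. Qed.

Lemma cdiscE (z : C) : cdisc z = (normc z <= 1) :> Prop.
Proof. by rewrite -lecR. Qed.

Lemma cdisc_compact : compact (@cdisc R).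
Proof.
pose g (p : R * R) : C := p.1 +i* p.2.
have gc : continuous g.
  move=> p; apply/(@cvgrPdist_lt _ _ _ (nbhs p)) => -[e b].
  rewrite ltcE /= => /andP[/eqP -> e0]; rewrite complexr0.
  near=> q.
  have h : g p - g q = (p.1 - q.1)%:C + 'i * (p.2 - q.2)%:C.
    by rewrite /g; simpc.
  rewrite h; apply: le_lt_trans (ler_normD _ _) _.
  rewrite normrM (_ : `|'i| = 1 :> C); last first.
    by rewrite normCE /Normc.normc /= expr0n expr1n add0r sqrtr1.
  rewrite mul1r.
  rewrite !normCr -rmorphD ltcR [ltRHS]splitr ltrD //; near: q.
    have : fst q @[q --> p] --> p.1 by exact: cvg_fst.
    by move/cvgrPdist_lt => /(_ _ (divr_gt0 e0 (ltr0Sn _ 1))).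
  have : snd q @[q --> p] --> p.2 by exact: cvg_snd.
  by move/cvgrPdist_lt => /(_ _ (divr_gt0 e0 (ltr0Sn _ 1))).
apply: (@subclosed_compact _ _ (g @` (`[(-1)%R, 1%R] `*` `[(-1)%R, 1%R]))).
- rewrite (_ : cdisc = normc @^-1` [set x : R | x <= 1]); last first.
    by apply/funext => z; rewrite cdiscE.
  apply: closed_comp; last exact: closed_le.
  by move=> x _; exact: normc_continuous.
- apply: continuous_compact; first exact: continuous_subspaceT.
  by apply: compact_setX; exact: segment_compact.
- move=> [a b]; rewrite cdiscE /= => h.
  have h2 : a ^+ 2 + b ^+ 2 <= 1.
    by rewrite -(@ler_sqrt _ _ 1) ?sqrtr1 // ltr01.
  exists (a, b) => //; split => /=; rewrite in_itv /= -ler_norml.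
    rewrite -(@ler_pXn2r _ 2) ?nnegrE // expr1n real_normK ?num_real //.
    by apply: le_trans h2; rewrite lerDl sqr_ge0.
  rewrite -(@ler_pXn2r _ 2) ?nnegrE // expr1n real_normK ?num_real //.
  by apply: le_trans h2; rewrite lerDr sqr_ge0.
Unshelve. all: by end_near. Qed.

Lemma discAlgebra_continuous (f : discAlgebra R) : {within cdisc, continuous f}.
Proof. by have := discfunP f; rewrite inE => -[]. Qed.

Lemma discAlgebra_holomorphic (f : discAlgebra R) : holomorphic disc f.
Proof. by have := discfunP f; rewrite inE => -[]. Qed.

Lemma discAlgebra_out (f : discAlgebra R) z : ~ cdisc z -> f z = 0.
Proof. by have := discfunP f; rewrite inE => -[_ _]; apply. Qed.

Lemma discAlgebra_eq (f g : discAlgebra R) :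
  (forall z, cdisc z -> f z = g z) -> f = g.
Proof.
move=> fg; apply/val_inj/funext => z /=.
have [zD|zD] := pselect (cdisc z); first exact: fg.
by rewrite !discAlgebra_out.
Qed.

Definition sup_norm (f : discAlgebra R) : R :=
  sup [set normc (f z) | z in cdisc].

Lemma cdisc0 : cdisc (0 : C). Proof. by rewrite /cdisc /= normr0 ler01. Qed.

Lemma has_sup_discAlgebra (f : discAlgebra R) :
  has_sup [set normc (f z) | z in cdisc].
Proof.
split; first by exists (normc (f 0)); exists 0 => //; exact: cdisc0.
have : compact ((normc \o f) @` (@cdisc R)).
  apply: continuous_compact; last exact: cdisc_compact.
  apply: within_continuous_comp; last exact: discAlgebra_continuous.
  by move=> x _; exact: normc_continuous.
move=> cf; have [M [Mr Mb]] := compact_bounded cf.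
exists (M + 1) => _ [z zD <-].
apply: le_trans (ler_norm _) _.
by apply: (Mb (M + 1)); [rewrite ltrDl | exists z].
Qed.

Lemma le_sup_norm (f : discAlgebra R) z : cdisc z -> normc (f z) <= sup_norm f.
Proof.
move=> zD; apply: ub_le_sup; last by exists z.
by have [] := has_sup_discAlgebra f.
Qed.

Lemma sup_norm_le (f : discAlgebra R) r :
  (forall z, cdisc z -> normc (f z) <= r) -> sup_norm f <= r.
Proof.
move=> h; apply: ge_sup; first by have [] := has_sup_discAlgebra f.
by move=> _ [z zD <-]; exact: h.
Qed.

Lemma sup_norm_ge0 (f : discAlgebra R) : 0 <= sup_norm f.
Proof.
by apply: le_trans (le_sup_norm f cdisc0); case: (f 0) => a b; exact: sqrtr_ge0.
Qed.

Lemma discAlgebraD (f g : discAlgebra R) z : (f + g) z = f z + g z.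
Proof. by []. Qed.

Lemma discAlgebraZ a (f : discAlgebra R) z : (a *: f) z = a * f z.
Proof. by []. Qed.

Let nrm (f : discAlgebra R) : C := (sup_norm f)%:C.

Let nrmD f g : nrm (f + g) <= nrm f + nrm g.
Proof.
rewrite /nrm -rmorphD lecR; apply: sup_norm_le => z zD.
rewrite discAlgebraD; apply: le_trans (le_normcD _ _) _.
by apply: lerD; exact: le_sup_norm.
Qed.

Let nrmZ_le a f : sup_norm (a *: f) <= normc a * sup_norm f.
Proof.
apply: sup_norm_le => z zD; rewrite discAlgebraZ normcM.
by apply: ler_wpM2l (le_sup_norm _ zD); case: a => x y; exact: sqrtr_ge0.
Qed.

Let nrmZ a f : nrm (a *: f) = `|a| * nrm f.
Proof.
rewrite /nrm normCE -rmorphM; congr (_%:C).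
apply/eqP; rewrite eq_le nrmZ_le /=.
have [->|a0] := eqVneq a 0; first by rewrite normc0 mul0r sup_norm_ge0.
have na0 : 0 < normc a by rewrite -ltcR -normCE normr_gt0.
rewrite -ler_pdivlMl // -normcV.
by apply: le_trans (nrmZ_le _ _); rewrite scalerA mulVf // scale1r.
Qed.

Let nrm0 f : nrm f = 0 -> f = 0.
Proof.
move=> /(congr1 (@complex.Re R)) /= f0; apply: discAlgebra_eq => z zD.
apply: eq0_normc; apply/eqP; rewrite eq_le -{1}f0 le_sup_norm //=.
by case: (f z) => a b; exact: sqrtr_ge0.
Qed.

(* Norms live in the scalar field R[i]; a nonnegative element of R[i] is a
   nonnegative real. *)
HB.instance Definition _ :=
  Lmodule_isNormed.Build C (discAlgebra R) nrmD nrmZ nrm0.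

Lemma discAlgebra_normE (f : discAlgebra R) : `|f| = (sup_norm f)%:C.
Proof. by []. Qed.

End sup_norm.

Arguments discAlgebra_continuous {R} f.
Arguments discAlgebra_holomorphic {R} f.

Section operators.
Variables (K : numFieldType) (X : normedModType K).

Definition bounded_operator (T : X -> X) :=
  linear T /\ exists M, forall x, `|T x| <= M * `|x|.

Definition ergodic_mean (T : X -> X) (n : nat) (x : X) : X :=
  n%:R^-1 *: \sum_(1 <= m < n.+1) iter m T x.

Definition mean_ergodic (T : X -> X) :=
  bounded_operator T /\
  exists2 P : X -> X, bounded_operator P &
    forall x, ergodic_mean T n x @[n --> \oo] --> P x.

End operators.

Section composition_operator.
Variable R : realType.
Local Notation C := R[i].
Variable phi : discAlgebra R.
Hypothesis phi_cdisc : set_fun cdisc cdisc phi.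
Hypothesis phi_disc : set_fun disc disc phi.

Lemma disc_open : open (@disc R).
Proof.
rewrite (_ : disc = ball (0 : C) 1); first exact: ball_open.
by apply/funext => z; rewrite /disc -ball_normE /ball_ /= sub0r normrN.
Qed.

Lemma disc_cdisc : @disc R `<=` cdisc.
Proof. by move=> z; exact: ltW. Qed.

Lemma comp_disc_algebra (f : discAlgebra R) :
  patch (fun=> 0) cdisc (f \o phi) \in disc_algebra.
Proof.
rewrite inE; split.
- have cc : {within cdisc, continuous (f \o phi)}.
    apply/subspace_continuousP => z zD.
    have /subspace_continuousP/(_ _ zD) cphi := discAlgebra_continuous phi.
    have /subspace_continuousP/(_ _ (phi_cdisc zD)) cf :=
      discAlgebra_continuous f.
    apply: cvg_comp cf => U /= hU.
    have := cphi _ hU; rewrite /= !nbhs_simpl /within /=.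
    by apply: filterS => w h wD; apply: h => //; exact: phi_cdisc.
  by apply: subspace_eq_continuous cc => w wD; rewrite /from_subspace patchT.
- move=> z zD.
  apply: (@near_eq_derivable _ C C (f \o phi)).
    have := open_nbhs_nbhs (conj disc_open zD).
    by apply: filterS => w /disc_cdisc wD; rewrite patchT ?inE.
  apply/derivable1_diffP; apply: differentiable_comp; apply/derivable1_diffP.
    exact: discAlgebra_holomorphic.
  by apply: discAlgebra_holomorphic; exact: phi_disc.
- by move=> z zD; rewrite patchC ?inE.
Qed.

(* The composition f \o phi, cut off outside the closed disc as required by the
   encoding of the disc algebra. *)
Definition comp_op (f : discAlgebra R) : discAlgebra R :=
  DiscAlgebra (comp_disc_algebra f).

Lemma comp_opE f z : cdisc z -> comp_op f z = f (phi z).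
Proof. by move=> zD; rewrite /comp_op /= patchT ?inE. Qed.

Lemma comp_op_bounded : bounded_operator comp_op.
Proof.
split.
  move=> a f g; apply: discAlgebra_eq => z zD.
  by rewrite discAlgebraD discAlgebraZ !comp_opE // discAlgebraD discAlgebraZ.
exists 1 => f; rewrite mul1r !discAlgebra_normE lecR.
apply: sup_norm_le => z zD; rewrite comp_opE //.
by apply: le_sup_norm; exact: phi_cdisc.
Qed.

End composition_operator.

Definition finite_blaschke (R : realType) (phi : R[i] -> R[i]) :=
  exists (lam : R) (n : nat) (a : 'I_n -> R[i]),
    [/\ (0 < n)%N, forall i, disc (a i) &
        forall z, cdisc z ->
          phi z = (cos lam +i* sin lam) *
                  \prod_(i < n) ((z - a i) / (1 - z * (a i)^*))].

Section blaschke.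
Variable R : realType.
Local Notation C := R[i].

Lemma norm_blaschke_factor (a z : C) :
  disc a -> disc z -> `|(z - a) / (1 - z * a^*)| < 1.
Proof.
rewrite /disc /= => aD zD.
have h : `|1 - z * a^*| ^+ 2 - `|z - a| ^+ 2
         = (1 - `|z| ^+ 2) * (1 - `|a| ^+ 2).
  rewrite !normCK !rmorphB rmorph1 rmorphM /= conjCK.
  by ring.
have p : 0 < (1 - `|z| ^+ 2) * (1 - `|a| ^+ 2).
  by rewrite mulr_gt0 // subr_gt0 expr_lt1.
have lt : `|z - a| < `|1 - z * a^*|.
  by rewrite -(@ltr_pXn2r _ 2) ?nnegrE // -subr_gt0 h.
rewrite normrM normfV ltr_pdivrMr ?mul1r //.
by apply: le_lt_trans lt.
Qed.

Lemma finite_blaschke_disc (phi : C -> C) :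
  finite_blaschke phi -> set_fun disc disc phi.
Proof.
move=> [lam [[|n] [a [// _ aD phiE]]]] z zD.
rewrite phiE; last exact: disc_cdisc.
rewrite /disc /= normrM (_ : `|_ +i* _| = 1); last first.
  by rewrite normCE /ComplexField.Normc.normc cos2Dsin2 sqrtr1.
rewrite mul1r big_ord_recl normrM normr_prod.
apply: le_lt_trans (norm_blaschke_factor (aD ord0) zD).
apply: ler_piMr => //; apply: prodr_ile1 => i _.
by rewrite normr_ge0 ltW // norm_blaschke_factor.
Qed.

End blaschke.

Section dynamics.
Variable R : realType.
Local Notation C := R[i].

Definition automorphism (phi : C -> C) :=
  holomorphic disc phi /\ set_bij disc disc phi.

Definition elliptic_automorphism (phi : C -> C) :=
  automorphism phi /\ exists! z : C, disc z /\ phi z = z.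

(* Locally uniform convergence of the iterates is uniform convergence on each
   compact subset of the open disc. *)
Definition denjoy_wolff (phi : C -> C) : C -> Prop :=
  unique (fun w : C => cdisc w /\
    {family compactly_in disc,
      (fun n => iter n phi) @ \oo --> (cst w : C -> C)}).

(* The derivative is taken along the closed disc, since phi carries no
   information outside of it; for a map that extends holomorphically across the
   boundary point z0 this is the derivative of the extension. *)
Definition boundary_derivative (phi : discAlgebra R) (z0 l : C) :=
  (phi z - phi z0) / (z - z0) @[z --> within cdisc z0^'] --> l.

Definition parabolic_automorphism (phi : discAlgebra R) :=
  automorphism phi /\
  exists z0 : C,
    [/\ `|z0| = 1, denjoy_wolff phi z0 & boundary_derivative phi z0 1].

End dynamics.

(* Main.v *)
(* If the means of the identity converge, their limit [h] is continuous and
   [phi]-invariant with [h z0 = z0]; since interior points are attracted to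
   [z0], [h] is constant, and therefore [phi] has no point of period 1 or 2 on
   the circle other than [z0]. A Blaschke product of degree [n >= 2] always has
   one: by the intermediate value theorem applied to [psi \o psi - id], where
   [psi] is a lift of [phi] to the line. In degree 1 the fixed points are the
   roots of a quadratic equation, both on the circle; if they coincide, the
   derivative at [z0] is 1.
   Conversely a parabolic automorphism is a translation by [- kap] in the
   coordinate [1 / (z - z0)], so an orbit spends a uniformly bounded time
   outside a given neighbourhood of [z0], and the means of [f] converge
   uniformly to [f z0]. *)
Require Import Defs.
From mathcomp Require Import all_boot all_order all_algebra.
From mathcomp Require Import complex.
From mathcomp Require Import all_classical all_reals all_analysis.
From mathcomp Require Import ring lra zify.

Set Implicit Arguments.
Unset Strict Implicit.
Unset Printing Implicit Defensive.

Import Order.TTheory GRing.Theory Num.Theory.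
Import numFieldTopology.Exports numFieldNormedType.Exports.

Local Open Scope classical_set_scope.
Local Open Scope ring_scope.

(** * The unit circle parametrized by angles *)

Section unit_circle.
Context {R : realType}.
Local Notation C := R[i].
Implicit Types (s t : R) (z : C).

Definition cis t : C := (cos t +i* sin t)%C.

Lemma cisD s t : cis (s + t) = cis s * cis t.
Proof. by rewrite /cis cosD sinD; simpc; congr (_ +i* _)%C; rewrite addrC. Qed.

Lemma cis0 : cis 0 = 1.
Proof. by rewrite /cis cos0 sin0. Qed.

Lemma conj_cis t : (cis t)^* = cis (- t).
Proof. by rewrite /cis cosN sinN. Qed.

Lemma norm_cis t : `|cis t| = 1.
Proof. by rewrite normc_def /= cos2Dsin2 sqrtr1. Qed.

Lemma cis_neq0 t : cis t != 0.
Proof. by rewrite -normr_eq0 norm_cis oner_eq0. Qed.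

Lemma cisN t : cis (- t) = (cis t)^-1.
Proof.
by apply: (mulfI (cis_neq0 t)); rewrite -cisD subrr cis0 mulfV ?cis_neq0.
Qed.

Lemma cis_sum (I : Type) (r : seq I) (F : I -> R) :
  cis (\sum_(i <- r) F i) = \prod_(i <- r) cis (F i).
Proof. exact: (big_morph cis cisD cis0). Qed.

Lemma cisMn t n : cis (t *+ n) = cis t ^+ n.
Proof. by elim: n => [|n ih]; rewrite ?cis0 // mulrS cisD ih exprS. Qed.

Lemma cis_2pi : cis (pi *+ 2) = 1.
Proof. by rewrite /cis cos2pi sin2pi. Qed.

Lemma cis_D2pi t n : cis (t + pi *+ 2 *+ n) = cis t.
Proof. by rewrite cisD cisMn cis_2pi expr1n mulr1. Qed.

(** The real part is [1 - 2 sin(t/2)^2], and the sine is positive because [t / 2] lies strictly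
    between 0 and [pi]. *)
Lemma cis_neq1 t : 0 < t < pi *+ 2 -> cis t != 1.
Proof.
move=> /andP[t0 t2]; apply/negP => /eqP /(congr1 (@complex.Re R)) /=.
have h : 0 < t / 2 < pi.
  by rewrite divr_gt0 //= ltr_pdivrMr // mulr_natr.
have s0 := sin_gt0_pi h.
rewrite [t in cos t](_ : t = (t / 2) *+ 2) ?cos_mulr2n; last by field.
have := cos2Dsin2 (t / 2); nra.
Qed.

Lemma cis_surj z : `|z| = 1 -> exists t, z = cis t.
Proof.
case: z => x y; rewrite normc_def /= => -[] /(congr1 (fun r => r ^+ 2)).
rewrite expr1n sqr_sqrtr ?addr_ge0 ?sqr_ge0 // => h.
have xb : -1 <= x <= 1 by apply/andP; split; nra.
have h1 : 1 - x ^+ 2 = y ^+ 2 by rewrite -h addrAC subrr add0r.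
have [y0|y0] := leP 0 y.
  by exists (acos x); rewrite /cis acosK // sin_acos // h1 sqrtr_sqr ger0_norm.
exists (- acos x).
by rewrite /cis cosN sinN acosK // sin_acos // h1 sqrtr_sqr ltr0_norm // opprK.
Qed.

End unit_circle.

(** * Lifting a Blaschke product to the real line; points of period 2 *)

Section blaschke_lift.
Context {R : realType}.
Local Notation C := R[i].
Implicit Types (t : R) (a z : C).

Lemma disc_conj_mul a z : disc a -> cdisc z -> `|z * a^*| < 1.
Proof.
rewrite /disc /cdisc /= => aD zD; rewrite normrM norm_conjC.
by apply: le_lt_trans aD; rewrite ler_piMl.
Qed.

Lemma blaschke_den_neq0 a z : disc a -> cdisc z -> 1 - z * a^* != 0.
Proof.
move=> aD zD; rewrite subr_eq0; apply/eqP => h.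
by have := disc_conj_mul aD zD; rewrite -h normr1 ltxx.
Qed.

Lemma blaschke_den_Re_gt0 a z :
  disc a -> cdisc z -> 0 < complex.Re (1 - z * a^*).
Proof.
move=> aD zD; have := disc_conj_mul aD zD; set w := z * _ => wD.
have : `|complex.Re w| < 1.
  by rewrite -ltcR; apply: le_lt_trans wD; exact: normc_ge_Re.
by case: w {wD} => p q; rewrite /= ltr_norml => /andP[_]; rewrite subr_gt0.
Qed.

(** Half the angle by which the Blaschke factor with zero [a] turns [cis t] backwards. *)
Definition half_turn a t : R :=
  let u := 1 - cis t * a^* in atan (complex.Im u / complex.Re u).

(* On the circle, [z - a = z * u^*] with [u = 1 - z * a^*], and [u] lies in the
   right half plane, so its argument is given by [atan]. *)
Lemma blaschke_factor_cis a t : disc a ->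
  (cis t - a) / (1 - cis t * a^*) = cis (t - half_turn a t *+ 2).
Proof.
move=> aD.
have zD : cdisc (cis t) by rewrite /cdisc /= norm_cis.
have u0 := blaschke_den_neq0 aD zD; have x0 := blaschke_den_Re_gt0 aD zD.
rewrite /half_turn; set u := 1 - _ in u0 x0 *.
set al := atan _.
have -> : cis t - a = cis t * u^*.
  rewrite /u rmorphB rmorph1 rmorphM /= conjCK mulrBr mulr1 mulrA conj_cis cisN.
  by rewrite mulfV ?cis_neq0 // mul1r.
have cal : cos al != 0.
  by rewrite gt_eqF // cos_gt0_pihalf // atan_gtNpi2 atan_ltpi2.
(* Polar form of [u]: the real factor is its modulus, and it cancels in the quotient of [u^*] by
   [u]. *)
have uE : u = (complex.Re u / cos al)%:C%C * cis al.
  have : tan al = complex.Im u / complex.Re u by rewrite atanK.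
  rewrite /tan => /(congr1 ( *%R (cos al))); rewrite mulrC divfK // => sE.
  case: (u) x0 sE => x y /= x0 sE.
  have xN0 : x != 0 by rewrite gt_eqF.
  by rewrite /cis; simpc; congr (_ +i* _)%C; rewrite ?sE; field; rewrite ?xN0.
have k0 : (complex.Re u / cos al)%:C%C != 0 :> C.
  by rewrite fmorph_eq0 mulf_eq0 invr_eq0 negb_or cal gt_eqF.
have kJ : ((complex.Re u / cos al)%:C)%C^* = (complex.Re u / cos al)%:C%C :> C.
  exact: conjc_real.
rewrite uE rmorphM /= kJ conj_cis invfM -mulrA [X in _ * X]mulrACA mulfV //.
rewrite mul1r.
by rewrite -cisN -cisD -cisD; congr cis; rewrite mulr2n; ring.
Qed.

(** Written out, the argument of [atan] is a quotient of trigonometric polynomials whose denominator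
    is the positive real part of [1 - cis t * a^*]. *)
Lemma half_turn_continuous a : disc a -> continuous (half_turn a).
Proof.
move=> aD t.
have x0 : complex.Re (1 - cis t * a^*) != 0.
  by rewrite gt_eqF // blaschke_den_Re_gt0 // /cdisc /= norm_cis.
have -> : half_turn a = atan \o (fun s =>
    (complex.Im a * cos s - complex.Re a * sin s) *
    (1 - (complex.Re a * cos s + complex.Im a * sin s))^-1).
  apply/funext => s; rewrite /half_turn /cis /=; case: a {aD x0} => p q.
  rewrite (_ : (_ +i* _)%C^* = (p -i* q)%C) // /=; simpc => /=.
  by congr atan; rewrite -mulNr; congr (_ / _); ring.
apply: continuous_comp; last exact: continuous_atan.
have cc : {for t, continuous cos} by exact: continuous_cos.
have cs : {for t, continuous sin} by exact: continuous_sin.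
have cnum : {for t, continuous
    (fun s => complex.Im a * cos s - complex.Re a * sin s)}.
  by apply: cvgB; apply: cvgM => //; exact: cvg_cst.
have cden : {for t, continuous
    (fun s => 1 - (complex.Re a * cos s + complex.Im a * sin s))}.
  apply: cvgB; first exact: cvg_cst.
  by apply: cvgD; apply: cvgM => //; exact: cvg_cst.
apply: cvgM; first exact: cnum.
apply: cvgV; last exact: cden.
move: x0; rewrite /cis; case: a {aD cnum cden} => p q.
rewrite (_ : (_ +i* _)%C^* = (p -i* q)%C) //; simpc => /=.
by rewrite [cos t * _]mulrC [sin t * _]mulrC [- _ - _]addrC.
Qed.

Definition blaschke_lift (lam : R) n (a : 'I_n -> C) t : R :=
  lam + \sum_(i < n) (t - half_turn (a i) t *+ 2).

Section fixed_blaschke.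
Variables (lam : R) (n : nat) (a : 'I_n -> C).
Hypothesis aD : forall i, disc (a i).

Lemma blaschke_lift_cis t :
  cis lam * \prod_(i < n) ((cis t - a i) / (1 - cis t * (a i)^*)) =
  cis (blaschke_lift lam a t).
Proof.
rewrite /blaschke_lift cisD cis_sum; congr (_ * _).
by apply: eq_bigr => i _; exact: blaschke_factor_cis.
Qed.

Lemma blaschke_lift_continuous : continuous (blaschke_lift lam a).
Proof.
move=> t; apply: cvgD; first exact: cvg_cst.
apply: cvg_big => [|i _]; first exact: add_continuous.
apply: cvgB; first exact: cvg_id.
by apply: cvgMn; exact: half_turn_continuous.
Qed.

(** Since [half_turn] has period [2 pi], each of the [n] summands gains [2 pi k]: on the circle the
    product has degree [n]. *)
Lemma blaschke_lift_D2pi t k :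
  blaschke_lift lam a (t + pi *+ 2 *+ k) =
  blaschke_lift lam a t + pi *+ 2 *+ (k * n).
Proof.
rewrite /blaschke_lift -addrA; congr (_ + _).
under eq_bigr do rewrite /half_turn cis_D2pi addrAC.
by rewrite big_split /= sumr_const card_ord mulrnA.
Qed.

End fixed_blaschke.

(* With [psi] a lift of [f], the function [psi \o psi - id] increases by
   [2 pi (n ^ 2 - 1) >= 6 pi] over a period, so it also takes the value
   [psi (psi t0) - t0 + 2 pi] strictly inside the period starting at a lift
   [t0] of [z0]. *)
Lemma circle_map_period2 (f : C -> C) (psi : R -> R) n (z0 : C) :
  (1 < n)%N -> continuous psi ->
  (forall t, f (cis t) = cis (psi t)) ->
  (forall t k, psi (t + pi *+ 2 *+ k) = psi t + pi *+ 2 *+ (k * n)) ->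
  `|z0| = 1 -> f (f z0) = z0 ->
  exists z, [/\ `|z| = 1, z != z0 & f (f z) = z].
Proof.
move=> n1 psic fpsi psiD /cis_surj[t0 ->] ffz0.
have p0 : 0 < pi *+ 2 :> R by rewrite pmulrn_lgt0 // pi_gt0.
pose g t := psi (psi t) - t.
have gD : g (t0 + pi *+ 2) = g t0 + pi *+ 2 *+ (n * n - 1).
  have := psiD t0 1; rewrite mulr1n mul1n /g => ->; rewrite psiD.
  by rewrite mulrnBr ?muln_gt0 ?(ltnW n1) // mulr1n; ring.
have n2 : (3 <= n * n - 1)%N by case: n n1 {psiD gD} => [|[|n]] //; lia.
have gc : {within `[t0, t0 + pi *+ 2], continuous g}.
  apply: continuous_subspaceT => t; apply: cvgB; last exact: cvg_id.
  by apply: continuous_comp; exact: psic.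
have [||t tI gt] := @IVT _ g t0 (t0 + pi *+ 2) (g t0 + pi *+ 2) _ gc.
- by rewrite lerDl ltW.
- rewrite gD; set m := (_ - 1)%N in n2 *.
  have : pi *+ 2 <= pi *+ 2 *+ m :> R.
    by rewrite -[leLHS]mulr1n ler_pMn2l //; lia.
  move=> h; rewrite ge_min le_max !lerD2l h orbT andbT.
  by rewrite lerDl (ltW p0).
exists (cis t); split; first exact: norm_cis.
  (* The value of [g] excludes both endpoints: it would force [2 pi = 0] at the left one and
     [n * n - 1 = 1] at the right one. *)
  have tN0 : t != t0.
    apply/eqP => h; move: gt; rewrite h -[LHS]addr0 => /addrI /eqP.
    by rewrite eq_sym gt_eqF.
  have tN1 : t != t0 + pi *+ 2.
    apply/eqP => h; move: gt; rewrite h gD => /addrI /eqP.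
    by rewrite -[eqbRHS]mulr1n gt_eqF // ltr_pMn2l //; lia.
  move: tI; rewrite in_itv /= !le_eqVlt eq_sym (negbTE tN0) (negbTE tN1) /=.
  move=> /andP[h1 h2].
  have -> : cis t = cis (t - t0) * cis t0 by rewrite -cisD subrK.
  rewrite -subr_eq0 -[X in _ - X]mul1r -mulrBl mulf_neq0 ?cis_neq0 //.
  by rewrite subr_eq0 cis_neq1 // subr_gt0 h1 ltrBlDl.
(* Points of period 2 are those with [cis (g s) = 1]. This holds at [t0], hence at [t], where [g]
   differs by [2 pi]. *)
have E s : f (f (cis s)) = cis (g s) * cis s.
  by rewrite !fpsi -cisD subrK.
have : cis (g t0) = 1.
  by apply: (mulIf (cis_neq0 t0)); rewrite -E mul1r.
by rewrite E gt cisD cis_2pi mulr1 => ->; rewrite mul1r.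
Qed.

End blaschke_lift.

(** * Disc algebra tools: radial approach, evaluation, extreme points *)

Section disc_algebra_extra.
Context {R : realType}.
Local Notation C := R[i].

Lemma cvg_mul_invn (K : C) : K * n%:R^-1 @[n --> \oo] --> (0 : C).
Proof.
rewrite -(mulr0 K); apply: cvgM; first exact: cvg_cst.
rewrite -cvg_shiftS; apply/cvgrPdist_lt => -[e b].
rewrite ltcE /= => /andP[/eqP -> e0]; rewrite complexr0.
have := @cvg_harmonic R; move/cvgrPdist_lt => /(_ e e0).
apply: filterS => n /=; rewrite /harmonic !sub0r !normrN => h.
by rewrite -[_%:R](rmorph_nat (real_complex R)) -fmorphV normCr ltcR.
Qed.

(** Approaches a boundary point from inside the disc; used both to extend identities to the circle
    and to test limits along the closed disc. *)
Lemma radial_cvg (w : C) : w - w * n.+1%:R^-1 @[n --> \oo] --> w.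
Proof.
rewrite -[X in _ --> X]subr0; apply: cvgB; first exact: cvg_cst.
by have := @cvg_mul_invn w; rewrite -cvg_shiftS.
Qed.

Lemma radial_disc (w : C) n : cdisc w -> disc (w - w * n.+1%:R^-1).
Proof.
move=> wD; rewrite /disc /= -[X in X - _]mulr1 -mulrBr normrM.
rewrite (le_lt_trans (ler_piMl _ wD)) // ger0_norm.
  by rewrite gtrDl oppr_lt0 invr_gt0 ltr0n.
by rewrite subr_ge0 invf_le1 ?ler1n ?ltr0n.
Qed.

Fact disc_restrict_subproof (f : C -> C) :
  continuous f -> holomorphic disc f ->
  patch (fun=> 0) cdisc f \in disc_algebra.
Proof.
move=> fc fh; rewrite inE; split.
- apply: (@subspace_eq_continuous _ _ _ f); last exact: continuous_subspaceT.
  by move=> z zD; rewrite /from_subspace patchT.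
- move=> z zD; apply: (@near_eq_derivable _ C C f); last exact: fh.
  have := open_nbhs_nbhs (conj (@disc_open R) zD).
  by apply: filterS => w /disc_cdisc wD; rewrite patchT ?inE.
- by move=> z zD; rewrite patchC ?inE.
Qed.

Definition disc_id : discAlgebra R :=
  DiscAlgebra (disc_restrict_subproof (fun z => @cvg_id _ (nbhs z))
    (fun z _ => @derivable_id C C z 1)).

Definition disc_cst (c : C) : discAlgebra R :=
  DiscAlgebra (disc_restrict_subproof (@cst_continuous _ _ c)
    (fun z _ => derivable_cst c z 1)).

Lemma disc_idE z : cdisc z -> disc_id z = z.
Proof. by move=> zD; rewrite /= patchT ?inE. Qed.

Lemma disc_cstE c z : cdisc z -> disc_cst c z = c.
Proof. by move=> zD; rewrite /= patchT ?inE. Qed.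

Lemma discAlgebra_sumE (I : Type) (r : seq I) (F : I -> discAlgebra R) z :
  (\sum_(i <- r) F i) z = \sum_(i <- r) F i z.
Proof. exact: (big_morph (fun f : discAlgebra R => f z)). Qed.

Lemma norm_discAlgebra_le (f : discAlgebra R) z : cdisc z -> `|f z| <= `|f|.
Proof. by move=> zD; rewrite discAlgebra_normE normCE lecR le_sup_norm. Qed.

Lemma discAlgebra_norm_le (f : discAlgebra R) (M : C) :
  (forall z, cdisc z -> `|f z| <= M) -> `|f| <= M.
Proof.
case: M => x y fM; rewrite discAlgebra_normE.
(* The bound at 0 already forces [M] to be real. *)
have := fM _ (@cdisc0 R); rewrite normCE lecE /= => /andP[/eqP -> _].
rewrite complexr0 lecR; apply: sup_norm_le => z /fM.
by rewrite normCE lecE => /andP[].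
Qed.

Lemma cvg_discAlgebra_eval (u : nat -> discAlgebra R) (f : discAlgebra R) z :
  cdisc z -> u n @[n --> \oo] --> f -> u n z @[n --> \oo] --> f z.
Proof.
move=> zD /cvgrPdist_lt uf; apply/cvgrPdist_lt => e /uf.
apply: filterS => n; apply: le_lt_trans.
exact: (norm_discAlgebra_le (f - u n) zD).
Qed.

Lemma cvg_discAlgebra_comp (f : discAlgebra R) (u : nat -> C) l :
  (forall n, cdisc (u n)) -> cdisc l ->
  u n @[n --> \oo] --> l -> f (u n) @[n --> \oo] --> f l.
Proof.
move=> uD lD ul.
have /subspace_continuousP/(_ _ lD) fl := discAlgebra_continuous f.
apply: cvg_comp fl => U /= lU.
have uU : nbhs \oo (fun n => cdisc (u n) -> U (u n)) by exact: ul _ lU.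
by apply: filterS uU => n; apply; exact: uD.
Qed.

(** Points of the circle are extreme in the closed disc: by the parallelogram law, [|z - w|^2] is at
    most [4 - |z0 + z0|^2 = 0]. *)
Lemma cdisc_strictly_convex (z0 z w : C) :
  `|z0| = 1 -> cdisc z -> cdisc w -> z + w = z0 + z0 -> z = z0.
Proof.
rewrite /cdisc /= => z01 zD wD zw.
have par : `|z - w| ^+ 2 + `|z + w| ^+ 2 = (`|z| ^+ 2 + `|w| ^+ 2) *+ 2.
  by rewrite !normCK !(rmorphB, rmorphD) /=; ring.
have : `|z - w| ^+ 2 <= 0.
  have : `|z| ^+ 2 + `|w| ^+ 2 <= 1 + 1 by apply: lerD; rewrite exprn_ile1.
  rewrite -(ler_pMn2r (ltn0Sn 1)) -par zw -mulr2n normrMn z01 -lerBrDr.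
  by rewrite (_ : (1 + 1) *+ 2 - _ = 0) //; ring.
move=> zw_le0.
have /eqP : `|z - w| ^+ 2 = 0 by apply: le_anti; rewrite zw_le0 exprn_ge0.
rewrite expf_eq0 normr_eq0 subr_eq0 /= => /eqP zwE.
move: zw; rewrite -zwE -!mulr2n => /eqP.
by rewrite eqrMn2r //= => /eqP.
Qed.

End disc_algebra_extra.

(** * Orbits, means along them, and points of period 2 *)

Section means.
Context {R : realType}.
Local Notation C := R[i].
Variable phi : discAlgebra R.
Hypothesis phi_cdisc : set_fun cdisc cdisc phi.
Hypothesis phi_disc : set_fun disc disc phi.
Local Notation T := (comp_op phi_cdisc phi_disc).

Lemma iter_cdisc n z : cdisc z -> cdisc (iter n phi z).
Proof. by move=> zD; elim: n => //= n; exact: phi_cdisc. Qed.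

Lemma iter_disc n z : disc z -> disc (iter n phi z).
Proof. by move=> zD; elim: n => //= n; exact: phi_disc. Qed.

Lemma iter_comp_op n f z : cdisc z -> iter n T f z = f (iter n phi z).
Proof.
elim: n z => // n ih z zD.
by rewrite iterS comp_opE // ih ?iterSr //; exact: phi_cdisc.
Qed.

Lemma ergodic_meanE n f z : cdisc z ->
  ergodic_mean T n f z = n%:R^-1 * \sum_(1 <= m < n.+1) f (iter m phi z).
Proof.
move=> zD; rewrite /ergodic_mean discAlgebraZ discAlgebra_sumE.
by congr (_ * _); apply: eq_bigr => m _; exact: iter_comp_op.
Qed.

Variable z0 : C.
Hypothesis z0_boundary : `|z0| = 1.
Hypothesis z0_dw : denjoy_wolff phi z0.

Let z0D : cdisc z0. Proof. by rewrite /cdisc /= z0_boundary. Qed.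

Lemma denjoy_wolff_cvg z : disc z -> iter n phi z @[n --> \oo] --> z0.
Proof.
move=> zD; have [[_ + _]] := z0_dw.
rewrite -fam_cvgE => /fam_cvgP /(_ [set z]).
rewrite uniform_set1; apply.
by split; [move=> _ -> | exact: compact_set1].
Qed.

(** The orbit of 0 and its image under [phi] have the same limit [z0], and [phi] is continuous up to
    the circle. *)
Lemma denjoy_wolff_fixed : phi z0 = z0.
Proof.
have D0 : disc (0 : C) by rewrite /disc /= normr0 ltr01.
have := denjoy_wolff_cvg D0; rewrite -cvg_shiftS /= => h.
apply: norm_cvg_unique h.
apply: cvg_discAlgebra_comp (denjoy_wolff_cvg D0) => // n.
exact/iter_cdisc/disc_cdisc.
Qed.

(* The limit [h] of the means of the identity satisfies
   [h z + h (phi z) = z + phi z] at a point of period 2, while [h = z0] on the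
   whole closed disc. *)
Lemma mean_ergodic_no_period2 z : mean_ergodic T ->
  cdisc z -> phi (phi z) = z -> z = z0.
Proof.
move=> [_ [P _ /(_ (@disc_id R)) Ph]] zD zP.
set h : discAlgebra R := P (@disc_id R) in Ph.
have hcvg w : cdisc w ->
    n%:R^-1 * \sum_(1 <= m < n.+1) iter m phi w @[n --> \oo] --> h w.
  move=> wD; have := cvg_discAlgebra_eval wD Ph.
  apply: cvg_trans; apply: near_eq_cvg; apply: nearW => n.
  rewrite ergodic_meanE //; congr (_ * _); apply: eq_bigr => m _.
  by rewrite disc_idE //; exact: iter_cdisc.
(* The means at [w] and at [phi w] differ by a telescoping sum of norm at most 2, divided by [n]. *)
have hphi w : cdisc w -> h (phi w) = h w.
  move=> wD; apply/eqP; rewrite -subr_eq0; apply/eqP.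
  have : n%:R^-1 * \sum_(1 <= m < n.+1) iter m phi (phi w) -
      n%:R^-1 * \sum_(1 <= m < n.+1) iter m phi w @[n --> \oo] --> (0 : C).
    apply/cvgr0Pnorm_lt => e e0.
    have /cvgr0Pnorm_lt/(_ _ e0) := @cvg_mul_invn R (1 + 1).
    apply: filterS => n; apply: le_lt_trans; rewrite -mulrBr -sumrB.
    rewrite (telescope_sumr_eq (fun m => iter m phi w)) //; last first.
      by move=> m _; rewrite -iterSr.
    rewrite mulrC !normrM ler_wpM2r // (le_trans (ler_normB _ _)) //.
    by rewrite ger0_norm ?addr_ge0 // lerD //; exact: (@iter_cdisc _.+1).
  by apply: norm_cvg_unique; apply: cvgB; apply: hcvg => //; exact: phi_cdisc.
have hper w : cdisc w -> phi (phi w) = w -> h w + h (phi w) = w + phi w.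
  move=> wD ww.
  have : n%:R^-1 * \sum_(1 <= m < n.+1) iter m phi w +
      n%:R^-1 * \sum_(1 <= m < n.+1) iter m phi (phi w) @[n --> \oo] -->
      w + phi w.
    (* Each pair of summands equals [w + phi w], so the added means are constant from [n = 1] on; at
       [n = 0] they are 0. *)
    apply: cvg_near_cst; exists 1%N => // n /= n0.
    rewrite -mulrDr -big_split /=.
    rewrite (eq_bigr (fun=> w + phi w)) => [|m _].
      rewrite sumr_const_nat subn1 /= mulrnAr -mulrnAl -mulr_natr.
      by rewrite mulVf ?mul1r // pnatr_eq0 -lt0n.
    by elim: m => // m ih; rewrite -[RHS]ih !iterSr ww addrC.
  apply: norm_cvg_unique; apply: cvgD; apply: hcvg => //; exact: phi_cdisc.
have hz0 : h z0 = z0.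
  have := hper z0 z0D; rewrite !denjoy_wolff_fixed => /(_ erefl) /eqP.
  by rewrite -!mulr2n eqrMn2r => /eqP.
(* [h] is constant along the orbit of [w], which tends to [z0]. *)
have hD w : disc w -> h w = z0.
  move=> wD; rewrite -[RHS]hz0.
  have hw : h (iter n phi w) @[n --> \oo] --> h w.
    apply: cvg_near_cst; apply: nearW => n; elim: n => //= n <-.
    by rewrite hphi //; exact/disc_cdisc/iter_disc.
  apply: norm_cvg_unique hw _.
  apply: cvg_discAlgebra_comp (denjoy_wolff_cvg wD) => // n.
  exact/disc_cdisc/iter_disc.
have hcD w : cdisc w -> h w = z0.
  move=> wD.
  have hw : h (w - w * n.+1%:R^-1) @[n --> \oo] --> z0.
    apply: cvg_near_cst; apply: nearW => n.
    by rewrite hD //; exact: radial_disc.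
  apply: norm_cvg_unique hw.
  apply: (cvg_discAlgebra_comp _ wD (@radial_cvg _ w)) => n.
  exact/disc_cdisc/radial_disc.
(* Now [z + phi z = h z + h (phi z) = z0 + z0], and [z0] is an extreme point. *)
apply: (cdisc_strictly_convex z0_boundary zD (phi_cdisc zD)).
by rewrite -hper // !hcD //; exact: phi_cdisc.
Qed.

End means.

(** * Moebius maps of the disc and their fixed points on the circle *)

Section moebius.
Context {R : realType}.
Local Notation C := R[i].
Implicit Types (a c z w : C).

Definition moebius a z : C := (z - a) / (1 - z * a^*).

Lemma discN a : disc a -> disc (- a).
Proof. by rewrite /disc /= normrN. Qed.

Lemma moebius_disc a z : disc a -> disc z -> disc (moebius a z).
Proof. exact: norm_blaschke_factor. Qed.

Lemma moebiusK a z : disc a -> cdisc z -> moebius a (moebius (- a) z) = z.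
Proof.
move=> aD zD; rewrite /moebius rmorphN /= mulrN !opprK.
have h1 : 1 + z * a^* != 0.
  by have := blaschke_den_neq0 (discN aD) zD; rewrite rmorphN /= mulrN opprK.
have h2 : 1 - a * a^* != 0 := blaschke_den_neq0 aD (disc_cdisc aD).
have h3 : 1 - (z + a) / (1 + z * a^*) * a^* = (1 - a * a^*) / (1 + z * a^*).
  by field.
by rewrite h3; field; rewrite h1 h2.
Qed.

Lemma moebius_inj a : disc a -> {in cdisc &, injective (moebius a)}.
Proof.
move=> aD z w; rewrite !inE => zD wD /(congr1 (moebius (- a))).
by rewrite -{2 4}[a]opprK !moebiusK //; exact: discN.
Qed.

Lemma moebius_bij (f : C -> C) a c : disc a -> `|c| = 1 ->
  (forall z, disc z -> f z = c * moebius a z) -> set_bij disc disc f.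
Proof.
move=> aD c1 fE.
have c0 : c != 0 by rewrite -normr_eq0 c1 oner_eq0.
split=> [z zD|z w|w wD].
- by rewrite fE // /disc /= normrM c1 mul1r; exact: moebius_disc.
- rewrite !inE => zD wD; rewrite !fE // => /(mulfI c0).
  by apply: moebius_inj; rewrite // inE; exact: disc_cdisc.
- have wcD : disc (c^-1 * w) by rewrite /disc /= normrM normfV c1 invr1 mul1r.
  exists (moebius (- a) (c^-1 * w)); first exact/moebius_disc/wcD/discN.
  rewrite fE ?moebiusK ?mulVKf //; first exact: disc_cdisc.
  exact/moebius_disc/wcD/discN.
Qed.

(* All zeros coincide by injectivity, and a power map [w ^+ n] with [n >= 2] is
   not injective. *)
Lemma blaschke_inj_degree1 (f : C -> C) c n (a : 'I_n -> C) :
  (0 < n)%N -> (forall i, disc (a i)) ->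
  (forall z, cdisc z -> f z = c * \prod_(i < n) moebius (a i) z) ->
  {in disc &, injective f} -> n = 1%N.
Proof.
case: n a => [//|[//|n]] a _ aD fE finj; exfalso.
have fa0 i : f (a i) = 0.
  rewrite fE; last exact: disc_cdisc.
  by rewrite (bigD1 i) //= /moebius subrr !mul0r mulr0.
have aE i : a i = a ord0 by apply: finj; rewrite ?inE // !fa0.
have fE' z : cdisc z -> f z = c * moebius (a ord0) z ^+ n.+2.
  move=> zD; rewrite fE //; congr (_ * _).
  under eq_bigr do rewrite aE.
  by rewrite prodr_const card_ord.
(* With [t] one [n.+2]-th of a full turn, [cis t] is a root of unity other than 1. *)
have p0 : 0 < (pi *+ 2) / n.+2%:R :> R.
  by rewrite divr_gt0 // pmulrn_lgt0 // pi_gt0.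
have p2 : (pi *+ 2) / n.+2%:R < pi *+ 2 :> R.
  by rewrite ltr_pdivrMr // ltr_pMr ?ltr1n // pmulrn_lgt0 // pi_gt0.
set t := _ / _ in p0 p2.
have tn : cis t ^+ n.+2 = 1.
  by rewrite -cisMn -mulr_natr divfK ?pnatr_eq0 // cis_2pi.
have h2D : disc (2^-1 : C).
  by rewrite /disc /= ger0_norm ?invr_ge0 // invf_lt1 // ltr1n.
have h2tD : disc (2^-1 * cis t) by rewrite /disc /= normrM norm_cis mulr1.
have bD : disc (- a ord0) by exact: discN.
have : cis t = 1; last by apply/eqP/cis_neq1; rewrite p0 p2.
(* The points [1/2] and [cis t / 2] have the same [n.+2]-th power, so [f] agrees at their preimages
   under [moebius (a ord0)]; injectivity identifies them. *)
apply: (@mulfI _ (2^-1 : C)); first by rewrite invr_eq0 pnatr_eq0.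
rewrite mulr1; apply: (moebius_inj bD); rewrite ?inE; try exact: disc_cdisc.
apply: finj; rewrite ?inE; try exact: moebius_disc.
rewrite !fE' ?moebiusK //; try exact: disc_cdisc;
  try exact/disc_cdisc/moebius_disc.
by rewrite exprMn tn mulr1.
Qed.

Section fixed_points.
Variables (phi : discAlgebra R) (a c z0 : C).
Hypotheses (aD : disc a) (a0 : a != 0) (c1 : `|c| = 1) (z01 : `|z0| = 1).
Hypothesis phiE : forall z, cdisc z -> phi z = c * moebius a z.
Hypothesis phiz0 : phi z0 = z0.

Let z0D : cdisc z0. Proof. by rewrite /cdisc /= z01. Qed.
Let z0N0 : z0 != 0. Proof. by rewrite -normr_eq0 z01 oner_eq0. Qed.
Let aJ0 : a^* != 0. Proof. by rewrite fmorph_eq0. Qed.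
Let den z : cdisc z -> 1 - z * a^* != 0.
Proof. exact: blaschke_den_neq0. Qed.

(* The fixed points of [phi] are the roots of [a^* z^2 + (c - 1) z - c a]. *)
Definition other_fixed_point : C := - (c * a) / (a^* * z0).
Local Notation z1 := other_fixed_point.

Lemma other_fixed_point_norm : `|z1| = 1.
Proof.
rewrite /other_fixed_point normrM normrN normfV !normrM c1 z01 norm_conjC.
by rewrite mul1r mulr1 mulfV ?normr_eq0.
Qed.

Let z1D : cdisc z1. Proof. by rewrite /cdisc /= other_fixed_point_norm. Qed.

Lemma fixed_points_prod : a^* * z0 * z1 = - (c * a).
Proof. by rewrite /other_fixed_point mulrC divfK // mulf_neq0. Qed.

(** With [fixed_points_prod], these are Vieta's relations; here the equation [phi z0 = z0] is
    cleared of its denominator. *)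
Lemma fixed_points_sum : a^* * (z0 + z1) = 1 - c.
Proof.
have := phiz0; rewrite phiE // /moebius.
move=> /(congr1 (fun z => z * (1 - z0 * a^*))).
rewrite mulrA divfK ?den // => h; apply: (mulfI z0N0).
have -> : z0 * (a^* * (z0 + z1)) = z0 * z0 * a^* + a^* * z0 * z1 by ring.
rewrite fixed_points_prod.
have -> : c * a = c * z0 - z0 * (1 - z0 * a^*) by rewrite -h; ring.
by ring.
Qed.

(** The numerator of [phi z - z] is the fixed-point quadratic, factored through its two roots. *)
Lemma moebius_subr_id z : cdisc z ->
  phi z - z = a^* * (z - z0) * (z - z1) / (1 - z * a^*).
Proof.
move=> zD; apply: (mulIf (den zD)); rewrite divfK ?den // phiE // /moebius.
rewrite mulrBl mulrA divfK ?den //.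
have -> : a^* * (z - z0) * (z - z1) =
  a^* * z * z - a^* * (z0 + z1) * z + a^* * z0 * z1 by ring.
by rewrite fixed_points_sum fixed_points_prod; ring.
Qed.

Lemma other_fixed_pointE : phi z1 = z1.
Proof.
by apply/eqP; rewrite -subr_eq0 moebius_subr_id // subrr mulr0 mul0r.
Qed.

(** The difference quotient of [phi] at [z0] after cancelling [z - z0]; this form is continuous at
    [z0] too. *)
Let slope z := 1 + a^* * (z - z1) / (1 - z * a^*).

Lemma moebius_slope z : cdisc z -> z != z0 ->
  (phi z - phi z0) / (z - z0) = slope z.
Proof.
move=> zD zz0; rewrite phiz0 /slope.
have -> : phi z - z0 = (phi z - z) + (z - z0) by ring.
have dz := den zD; have zz0' : z - z0 != 0 by rewrite subr_eq0.
by rewrite moebius_subr_id //; field; rewrite dz zz0'.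
Qed.

Lemma moebius_boundary_derivative : boundary_derivative phi z0 (slope z0).
Proof.
have h : slope z @[z --> within cdisc z0^'] --> slope z0.
  apply: cvg_within_filter; apply: (@cvg_within_filter _ _ _ (nbhs z0)).
  apply: cvgD; first exact: cvg_cst.
  apply: cvgM.
    apply: cvgM; first exact: cvg_cst.
    by apply: cvgB; [exact: cvg_id | exact: cvg_cst].
  apply: cvgV; first exact: den.
  apply: cvgB; first exact: cvg_cst.
  by apply: cvgM; [exact: cvg_id | exact: cvg_cst].
apply: cvg_trans h; apply: near_eq_cvg.
rewrite near_withinE near_withinE; apply: nearW => z zz0 zD.
by rewrite moebius_slope.
Qed.

(** The derivative can only be [slope z0], whose excess over 1 is a nonzero multiple of
    [z0 - z1]. *)
Lemma boundary_derivative1P : boundary_derivative phi z0 1 <-> z1 = z0.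
Proof.
split=> [d1|z10]; last first.
  have := moebius_boundary_derivative.
  by rewrite /slope z10 subrr mulr0 mul0r addr0.
pose u n : C := z0 - z0 * n.+1%:R^-1.
have uD n : cdisc (u n) by apply: disc_cdisc; exact: radial_disc.
have uz0 n : u n != z0.
  by rewrite -subr_eq0 /u addrAC subrr add0r oppr_eq0 mulf_neq0.
(* A sequence in the closed disc that avoids [z0] lets the two limits be compared. *)
have uw : u n @[n --> \oo] --> within cdisc z0^'.
  move=> U zU.
  have zU' : nbhs z0 (fun z => z != z0 -> cdisc z -> U z) by exact: zU.
  have h : nbhs \oo (fun n => u n != z0 -> cdisc (u n) -> U (u n)).
    exact: (@radial_cvg _ z0 _ zU').
  by apply: filterS h => n; apply.
have h1 := cvg_comp _ _ uw d1.
have h2 := cvg_comp _ _ uw moebius_boundary_derivative.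
have : slope z0 == 1 by apply/eqP; exact: norm_cvg_unique h2 h1.
rewrite /slope addrC eq_sym -subr_eq subrr eq_sym.
rewrite !mulf_eq0 (negbTE aJ0) invr_eq0.
by rewrite (negbTE (den z0D)) orbF /= subr_eq0 => /eqP ->.
Qed.

End fixed_points.
End moebius.

(** * Translation dynamics and uniform convergence of the means *)

Section parabolic.
Context {R : realType}.
Local Notation C := R[i].

(** All indices counted lie between the least [m] satisfying [p] and [m + L]. *)
Lemma count_bounded_spread (p : pred nat) L n :
  (forall m k, p m -> p k -> (m <= k)%N -> (k <= m + L)%N) ->
  (count p (index_iota 1 n.+1) <= L.+1)%N.
Proof.
move=> pL; set s := [seq m <- index_iota 1 n.+1 | p m].
rewrite -size_filter -/s.
have [s0|[m0]] : s = [::] \/ exists m, m \in s.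
- by case: (s) => [|m s']; [left | right; exists m; rewrite inE eqxx].
- by rewrite s0.
rewrite mem_filter => /andP[pm0 _].
have ex : exists m, p m by exists m0.
case: (ex_minnP ex) => m pm mmin.
have -> : L.+1 = size (iota m L.+1) by rewrite size_iota.
apply: uniq_leq_size; first by rewrite filter_uniq // iota_uniq.
move=> k; rewrite mem_filter mem_iota => /andP[pk _].
by rewrite (mmin _ pk) addnS ltnS pL // mmin.
Qed.

Lemma complex_bound (K : C) : exists L : nat, `|K| < L%:R.
Proof.
exists (Num.bound (complex.Re `|K|)).
rewrite normCE -(rmorph_nat (real_complex R)) ltcR.
by apply: archi_boundP; case: (K) => x y /=; exact: sqrtr_ge0.
Qed.

Variables (phi : discAlgebra R) (z0 kap : C).
Hypothesis phi_cdisc : set_fun cdisc cdisc phi.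
Hypothesis phi_disc : set_fun disc disc phi.
Local Notation T := (comp_op phi_cdisc phi_disc).
Hypotheses (z0D : cdisc z0) (kap0 : kap != 0) (phiz0 : phi z0 = z0).
Hypothesis phi_translation : forall z, cdisc z -> z != z0 ->
  phi z != z0 /\ (phi z - z0)^-1 = (z - z0)^-1 - kap.

Lemma iter_phi_translation m z : cdisc z -> z != z0 ->
  (iter m phi z - z0)^-1 = (z - z0)^-1 - kap *+ m.
Proof.
move=> zD zz0.
have [] : iter m phi z != z0 /\
    (iter m phi z - z0)^-1 = (z - z0)^-1 - kap *+ m; last by [].
elim: m => [|m [n0 ih]]; first by rewrite mulr0n subr0.
have [h1 h2] := phi_translation (iter_cdisc phi_cdisc m zD) n0.
by split=> //; rewrite iterS h2 ih mulrSr opprD addrA.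
Qed.

(** In the coordinate [1 / (z - z0)], points at distance at least [d] from [z0] have modulus at most
    [1 / d]. Two such points of one orbit differ by [(k - m) kap], so [k - m] is at most
    [2 / (d |kap|)], uniformly in [z]. *)
Lemma orbit_far_bounded (d : C) : 0 < d -> exists L, forall z m k,
  cdisc z -> d <= `|iter m phi z - z0| -> d <= `|iter k phi z - z0| ->
  (m <= k)%N -> (k <= m + L)%N.
Proof.
move=> d0; have [L hL] := complex_bound ((d^-1 + d^-1) / `|kap|).
exists L => z m k zD dm dk mk.
have zz0 : z != z0.
  apply/eqP => zE; have : iter m phi z = z0.
    by rewrite zE; elim: (m) => //= j ->.
  by move=> h; move: dm; rewrite h subrr normr0 lt_geF.
have kap1 : 0 < `|kap| by rewrite normr_gt0.
have inv x : d <= `|x| -> `|x^-1| <= d^-1.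
  by move=> dx; rewrite normfV lef_pV2 // ?posrE //; exact: lt_le_trans dx.
rewrite -leq_subLR leqNgt; apply/negP => Lk.
have : `|kap| * L%:R < `|kap| * ((d^-1 + d^-1) / `|kap|).
  apply: (@lt_le_trans _ _ (`|kap| * (k - m)%:R)).
    by rewrite ltr_pM2l // ltr_nat.
  rewrite mulrCA mulfV ?mulr1 ?gt_eqF // mulr_natr -normrMn.
  have -> : kap *+ (k - m) =
      (iter m phi z - z0)^-1 - (iter k phi z - z0)^-1.
    by rewrite !iter_phi_translation // mulrnBr //; ring.
  by rewrite (le_trans (ler_normB _ _)) // lerD // inv.
rewrite ltr_pM2l // => /(lt_trans hL).
by rewrite ger0_norm ?ltxx // divr_ge0 // addr_ge0 // invr_ge0 ltW.
Qed.

Lemma discAlgebra_near (f : discAlgebra R) (e : C) : 0 < e ->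
  exists2 d : C, 0 < d &
    forall z, cdisc z -> `|z - z0| < d -> `|f z0 - f z| < e.
Proof.
move=> e0; have /subspace_continuousP/(_ _ z0D) := discAlgebra_continuous f.
move=> /cvgrPdist_lt/(_ _ e0); rewrite near_withinE => /nbhs_ballP[d /= d0 h].
exists d => // z zD zd; apply: h => //.
by rewrite -ball_normE /ball_ /= distrC.
Qed.

(** Orbit points near [z0] contribute at most [e] each. The others contribute at most [2 |f|] each,
    and their number is bounded independently of [z] and [n]. *)
Lemma mean_near (f : discAlgebra R) (e : C) : 0 < e ->
  exists L : nat, forall n, (0 < n)%N ->
    `|disc_cst (f z0) - ergodic_mean T n f| <=
    e + (`|f| + `|f|) * L%:R * n%:R^-1.
Proof.
move=> e0; have [d d0 fd] := discAlgebra_near f e0.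
have [L HL] := orbit_far_bounded d0.
exists L.+1 => n n0; apply: discAlgebra_norm_le => z zD.
have nr0 : n%:R != 0 :> C by rewrite pnatr_eq0 -lt0n.
have sub_eval (g h : discAlgebra R) w : (g - h) w = g w - h w by [].
rewrite sub_eval ergodic_meanE // disc_cstE //.
have -> : f z0 = n%:R^-1 * \sum_(1 <= m < n.+1) f z0.
  by rewrite sumr_const_nat subn1 /= -[X in _ * X]mulr_natr mulrCA mulVf ?mulr1.
rewrite -mulrBr -sumrB normrM normfV normr_nat.
rewrite mulrC ler_pdivrMr ?ltr0n // mulrDl divfK //.
pose p m := ~~ (`|f z0 - f (iter m phi z)| < e).
apply: (@le_trans _ _ (\sum_(1 <= m < n.+1) (e + (`|f| + `|f|) *+ p m))).
  rewrite (le_trans (ler_norm_sum _ _ _)) //; apply: ler_sum => m _.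
  rewrite /p; case: (boolP (_ < e)) => [/ltW h|_] /=; first by rewrite addr0.
  rewrite mulr1n (le_trans (ler_normB _ _)) // ler_wpDl ?(ltW e0) //.
  by rewrite lerD // norm_discAlgebra_le //; exact: iter_cdisc.
rewrite big_split /= sumr_const_nat subn1 /= -[e *+ n]mulr_natr lerD2l.
rewrite sumrMnr mulr_natr ler_wpMn2l ?addr_ge0 //.
have -> : (\sum_(1 <= m < n.+1) p m = count p (index_iota 1 n.+1))%N.
  by rewrite -sum1_count [RHS]big_mkcond; apply: eq_bigr => m _; case: (p m).
(* A spread of at most [L] means at most [L.+1] indices, whence the witness above. *)
apply: count_bounded_spread => m k pm pk.
have far i : p i -> d <= `|iter i phi z - z0|.
  rewrite real_leNgt ?normr_real ?gtr0_real //; apply: contra => zd.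
  by rewrite fd //; exact: iter_cdisc.
exact: HL zD (far _ pm) (far _ pk).
Qed.

Lemma parabolic_mean_ergodic : mean_ergodic T.
Proof.
split; first exact: comp_op_bounded.
exists (fun f : discAlgebra R => disc_cst (f z0)).
  split.
    move=> a f g; apply: discAlgebra_eq => z zD.
    by rewrite !discAlgebraD !discAlgebraZ !disc_cstE.
  exists 1 => f; rewrite mul1r; apply: discAlgebra_norm_le => z zD.
  by rewrite disc_cstE // norm_discAlgebra_le.
move=> f; apply/cvgrPdist_lt => e e0.
have e20 : 0 < e / 2 by rewrite divr_gt0.
have [L hL] := mean_near f e20.
have /cvgr0Pnorm_lt/(_ _ e20) := @cvg_mul_invn R ((`|f| + `|f|) * L%:R).
apply: filterS2 (nbhs_infty_gt 0) => n n0 h.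
apply: le_lt_trans (hL n n0) _; rewrite [ltRHS]splitr ltrD2l.
by apply: le_lt_trans h; rewrite ger0_norm // !mulr_ge0 ?invr_ge0 ?addr_ge0.
Qed.

End parabolic.

(** * Reduction to degree 1 and the equivalence *)

Lemma blaschke_period2 (R : realType) (phi : R[i] -> R[i]) (z0 : R[i])
    lam n (a : 'I_n -> R[i]) :
  (1 < n)%N -> (forall i, disc (a i)) ->
  (forall z, cdisc z -> phi z =
     cis lam * \prod_(i < n) moebius (a i) z) ->
  `|z0| = 1 -> phi z0 = z0 ->
  exists z, [/\ `|z| = 1, z != z0 & phi (phi z) = z].
Proof.
move=> n1 aD phiE z01 phiz0.
apply: (@circle_map_period2 _ _ (blaschke_lift lam a) n) => //; last first.
- by rewrite !phiz0.
- by move=> t k; exact: blaschke_lift_D2pi.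
- move=> t; rewrite phiE; first exact: blaschke_lift_cis.
  by rewrite /cdisc /= norm_cis.
- exact: blaschke_lift_continuous.
Qed.

Theorem proposition3p11 (R : realType) (phi : discAlgebra R)
    (phi_cdisc : set_fun cdisc cdisc phi)
    (phi_blaschke : finite_blaschke phi)
    (phi_not_elliptic : ~ elliptic_automorphism phi)
    (z0 : R[i]) (z0_boundary : `|z0| = 1) (z0_dw : denjoy_wolff phi z0) :
  mean_ergodic (comp_op phi_cdisc (finite_blaschke_disc phi_blaschke))
  <-> parabolic_automorphism phi.
Proof.
set phi_disc := finite_blaschke_disc phi_blaschke.
have [lam [n [a [n0 aD phiE]]]] := phi_blaschke.
have z0D : cdisc z0 by rewrite /cdisc /= z0_boundary.
have phiz0 := denjoy_wolff_fixed phi_cdisc z0_boundary z0_dw.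
have D0 : disc (0 : R[i]) by rewrite /disc /= normr0 ltr01.
(* Otherwise the orbit of 0 would not tend to the circle. In degree 1 this makes the zero [b]
   nonzero, so the fixed-point equation is truly quadratic. *)
have no_fixed : phi 0 != 0.
  apply/eqP => phi0; have := denjoy_wolff_cvg z0_dw D0.
  have h : iter n phi 0 @[n --> \oo] --> (0 : R[i]).
    by apply: cvg_near_cst; apply: nearW; elim=> //= m ->.
  move=> /(norm_cvg_unique h) z00; move: z0_boundary.
  by rewrite -z00 normr0 => /esym /eqP; rewrite oner_eq0.
have degree1 : n = 1%N -> exists2 b, disc b /\ b != 0 &
    forall z, cdisc z -> phi z = cis lam * moebius b z.
  case: n a n0 aD phiE => [|[|]] // a _ aD phiE _.
  have E z : cdisc z -> phi z = cis lam * moebius (a ord0) z.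
    by move=> zD; rewrite phiE // big_ord1.
  exists (a ord0) => //; split=> //; apply: contraNneq no_fixed => a0.
  by rewrite E ?a0 ?/moebius ?subr0 ?mul0r ?mulr0 //; exact: disc_cdisc.
split=> [me|[[_ [_ phi_inj _]] [w [w1 w_dw bd]]]].
- have n1 : n = 1%N.
    apply/eqP; rewrite eqn_leq n0 andbT leqNgt; apply/negP => n1.
    have [z [z1 zz0 zP]] := blaschke_period2 n1 aD phiE z0_boundary phiz0.
    case/eqP: zz0; apply: (mean_ergodic_no_period2 z0_boundary z0_dw me _ zP).
    by rewrite /cdisc /= z1.
  have [b [bD b0] phib] := degree1 n1.
  split.
    split; first exact: discAlgebra_holomorphic.
    apply: (moebius_bij bD (norm_cis lam)) => z zD.
    by rewrite phib //; exact: disc_cdisc.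
  exists z0; split => //.
  apply/(boundary_derivative1P bD b0 z0_boundary phib phiz0).
  set z1 := other_fixed_point _ _ _.
  have z1P : phi z1 = z1.
    exact: (other_fixed_pointE bD b0 (norm_cis lam) z0_boundary phib phiz0).
  (* The other fixed point also satisfies the period 2 equation, so it coincides with [z0]. *)
  apply: (mean_ergodic_no_period2 z0_boundary z0_dw me); last by rewrite !z1P.
  by rewrite /cdisc /= other_fixed_point_norm // norm_cis.
- have n1 : n = 1%N by apply: (blaschke_inj_degree1 n0 aD phiE phi_inj).
  have [b [bD b0] phib] := degree1 n1.
  (* Both points are the limit of the orbit of 0. *)
  have wz0 : w = z0.
    apply: norm_cvg_unique (denjoy_wolff_cvg w_dw D0)
                           (denjoy_wolff_cvg z0_dw D0).
  rewrite wz0 in bd.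
  have z10 : other_fixed_point b (cis lam) z0 = z0.
    exact/(boundary_derivative1P bD b0 z0_boundary phib phiz0).
  have d0 := blaschke_den_neq0 bD z0D.
  have bJ0 : b^* != 0 by rewrite fmorph_eq0.
  apply: (@parabolic_mean_ergodic _ _ z0 (b^* / (1 - z0 * b^*))) => //.
    by rewrite mulf_neq0 ?invr_eq0.
  move=> z zD zz0.
  have zz0' : z - z0 != 0 by rewrite subr_eq0.
  have dz := blaschke_den_neq0 bD zD.
  have E : phi z - z0 = (z - z0) * (1 - z0 * b^*) / (1 - z * b^*).
    have -> : phi z - z0 = (phi z - z) + (z - z0) by ring.
    rewrite (moebius_subr_id bD b0 z0_boundary phib phiz0 zD) z10.
    by field.
  split; first by rewrite -subr_eq0 E !mulf_neq0 ?invr_eq0.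
  by rewrite E; field; rewrite d0 dz zz0'.
Qed.
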